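(* The Assessors of the Sedenions are partitioned into exactly seven box-kites. Each box-kite consists of six Assessors, and its Co-Assessor graph is the edge graph of an octahedron (each Assessor is a Co-Assessor of all other Assessors of the box-kite except exactly one, its strut-opposite). Of the eight triangular faces of this octahedron, exactly four are Co-Assessor trios (''sails''), no two of which share an edge; three of the sails are trefoils and one is a triple zigzag. Likewise, among the remaining four faces (''vents''), three are trefoils and one is a triple zigzag.
   Context: The Sedenions are the 16-dimensional real (non-associative, distributive) algebra with basis $1,i_1,\dots,i_{15}$, where $1$ is the unit, $i_n^2=-1$, $i_mi_n=-i_ni_m$ for $m\ne n$, and for each triplet $(a,b,c)$ in the following list $i_ai_b=i_c$, $i_bi_c=i_a$, $i_ci_a=i_b$. O-trips: (1,2,3),(1,4,5),(1,7,6),(2,4,6),(2,5,7),(3,4,7),(3,6,5). S-trips: (1,8,9),(1,11,10),(1,13,12),(1,14,15),(2,8,10),(2,9,11),(2,14,12),(2,15,13),(3,8,11),(3,10,9),(3,15,12),(3,13,14),(4,8,12),(4,9,13),(4,10,14),(4,11,15),(5,8,13),(5,12,9),(5,10,15),(5,14,11),(6,8,14),(6,15,9),(6,12,10),(6,11,13),(7,8,15),(7,9,14),(7,13,10),(7,12,11). Thus $i_mi_n=\pm i_{m\oplus n}$, where $\oplus$ is bitwise XOR. Two (unordered) pairs $(A,B)$, $(C,D)$ of distinct indices in $\{1,\dots,15\}$ are Co-Assessors if $(i_A+s\,i_B)(i_C+t\,i_D)=0$ for some signs $s,t\in\{+1,-1\}$. A pair $(A,B)$ is an Assessor if it is a Co-Assessor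 of some pair. The Co-Assessor graph has the Assessors as vertices and an edge between any two Co-Assessors; a box-kite is a connected component of this graph. A Co-Assessor trio is a set of three pairwise Co-Assessor Assessors $(A,B),(C,D),(E,F)$ with $\{E,F\}=\{A\oplus C,\;A\oplus D\}$. Each Assessor is written $(a,S)$ with $a<S$. The edge joining two Co-Assessors $(a,S)$, $(b,T)$ is marked $+$ if $(i_a+i_S)(i_b+i_T)=0$ and $-$ if $(i_a+i_S)(i_b-i_T)=0$; exactly one of these holds. A triangle of pairwise Co-Assessors is a triple zigzag if its three edges are all marked $-$, and a trefoil if exactly two of its edges are marked $+$ and one is marked $-$. *)

(* Defs.v *)
From HB Require Import structures.
From mathcomp Require Import all_boot all_order all_algebra reals.

Set Implicit Arguments.
Unset Strict Implicit.
Unset Printing Implicit Defensive.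

Import Order.TTheory GRing.Theory Num.Theory.
Local Open Scope ring_scope.

(* A sedenion x is the row vector of its coordinates in the basis
   1, i_1, ..., i_15: entry 0 is the real part, entry k > 0 is along i_k. *)
Definition sedenion (R : realType) := 'rV[R]_16.

Definition o_trips : seq (nat * nat * nat) :=
  [:: (1, 2, 3); (1, 4, 5); (1, 7, 6); (2, 4, 6); (2, 5, 7); (3, 4, 7);
      (3, 6, 5)]%N.

Definition s_trips : seq (nat * nat * nat) :=
  [:: (1, 8, 9); (1, 11, 10); (1, 13, 12); (1, 14, 15);
      (2, 8, 10); (2, 9, 11); (2, 14, 12); (2, 15, 13);
      (3, 8, 11); (3, 10, 9); (3, 15, 12); (3, 13, 14);
      (4, 8, 12); (4, 9, 13); (4, 10, 14); (4, 11, 15);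
      (5, 8, 13); (5, 12, 9); (5, 10, 15); (5, 14, 11);
      (6, 8, 14); (6, 15, 9); (6, 12, 10); (6, 11, 13);
      (7, 8, 15); (7, 9, 14); (7, 13, 10); (7, 12, 11)]%N.

Definition cyclic_trips : seq (nat * nat * nat) :=
  flatten [seq [:: (t.1.1, t.1.2, t.2); (t.1.2, t.2, t.1.1);
                   (t.2, t.1.1, t.1.2)] | t <- o_trips ++ s_trips].

(* Some c when i_m i_n = i_c is read off a trip. *)
Definition trip_prod (m n : nat) : option nat :=
  ohead [seq t.2 | t <- cyclic_trips & t.1 == (m, n)].

Definition basis (R : realType) (n : nat) : sedenion R :=
  \row_(j < 16) (j == n :> nat)%:R.

(* The last branch is never reached for m, n < 16
   (trip_prod_cover). *)
Definition basis_mul (R : realType) (m n : nat) : sedenion R :=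
  if m == 0%N then basis R n
  else if n == 0%N then basis R m
  else if m == n then - basis R 0%N
  else if trip_prod m n is Some c then basis R c
  else if trip_prod n m is Some c then - basis R c
  else 0.

Definition sed_mul (R : realType) (x y : sedenion R) : sedenion R :=
  \sum_(m < 16) \sum_(n < 16) (x 0 m * y 0 n) *: basis_mul R m n.

Lemma trip_prod_cover (m n : nat) :
  (0 < m < 16)%N -> (0 < n < 16)%N -> m != n ->
  (trip_prod m n == Some (Nat.lxor m n)) && (trip_prod n m == None)
  || (trip_prod n m == Some (Nat.lxor m n)) && (trip_prod m n == None).
Proof.
move=> /andP[m0 m16] /andP[n0 n16] mn.
pose ok i j := (0 < i)%N ==> (0 < j)%N ==> (i != j) ==>
  ((trip_prod i j == Some (Nat.lxor i j)) && (trip_prod j i == None)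
  || (trip_prod j i == Some (Nat.lxor i j)) && (trip_prod i j == None)).
have /allP h : all (fun i => all (ok i) (iota 0 16)) (iota 0 16) by vm_compute.
have /h/allP/(_ n) : m \in iota 0 16 by rewrite mem_iota.
by rewrite mem_iota n16 /ok m0 n0 mn; apply.
Qed.

Lemma sed_mul_basis (R : realType) (m n : 'I_16) :
  sed_mul (basis R m) (basis R n) = basis_mul R m n.
Proof.
rewrite /sed_mul (bigD1 m) //= [X in _ + X]big1 ?addr0 => [|i im].
  rewrite (bigD1 n) //= big1 ?addr0 => [|j jn].
    by rewrite !mxE !eqxx mulr1 scale1r.
  by rewrite !mxE [j == n :> nat](negPf jn) mulr0 scale0r.
by apply: big1 => j _; rewrite !mxE [i == m :> nat](negPf im) mul0r scale0r.
Qed.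

(* The unordered pair {A, B} is represented by (A, B) with A < B. *)
Definition index_pair : finType := ('I_16 * 'I_16)%type.

Definition is_pair (P : index_pair) : bool := (0 < P.1 < P.2)%N.

(* i_A + i_B for s = false, i_A - i_B for s = true. *)
Definition diagonal (R : realType) (P : index_pair) (s : bool) : sedenion R :=
  basis R P.1 + (-1) ^+ s *: basis R P.2.

Definition coassessor (R : realType) : rel index_pair := fun P Q =>
  [&& is_pair P, is_pair Q &
      [exists s : bool, exists t : bool,
         sed_mul (diagonal R P s) (diagonal R Q t) == 0]].

Definition assessors (R : realType) : {set index_pair} :=
  [set P | [exists Q, coassessor R P Q]].

Definition box_kites (R : realType) : {set {set index_pair}} :=
  [set [set Q in assessors R | connect (coassessor R) P Q]
     | P in assessors R].

(* The octahedron with vertices +e_k, -e_k (k < 3): two vertices are adjacent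
   unless they are on the same axis, and a face picks one vertex per axis. *)
Definition octa_vertex : finType := ('I_3 * bool)%type.

Definition octa_adj : rel octa_vertex := fun x y => x.1 != y.1.

Definition octa_faces : {set {set octa_vertex}} :=
  [set [set (k, s k) | k : 'I_3] | s : {ffun 'I_3 -> bool}].

Definition octa_iso (R : realType) (K : {set index_pair})
    (f : octa_vertex -> index_pair) : Prop :=
  [/\ injective f, [set f x | x : octa_vertex] = K
    & forall x y, coassessor R (f x) (f y) = octa_adj x y].

Definition triangle (R : realType) (F : {set index_pair}) : bool :=
  (#|F| == 3%N) &&
  [forall P in F, forall Q in F, (P != Q) ==> coassessor R P Q].

Definition faces (R : realType) (K : {set index_pair}) :
    {set {set index_pair}} :=
  [set F : {set index_pair} | (F \subset K) && triangle R F].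

(* For pairwise Co-Assessors the condition on (E, F) depends neither on the
   order of the three pairs nor on the order inside each pair, so it does not
   matter that it is asked for some labelling. *)
Definition trio (R : realType) (F : {set index_pair}) : bool :=
  triangle R F &&
  [exists P : index_pair, exists Q : index_pair, exists T : index_pair,
     (F == [set P; Q; T]) &&
     perm_eq [:: val T.1; val T.2]
             [:: Nat.lxor (val P.1) (val Q.1); Nat.lxor (val P.1) (val Q.2)]].

Definition edges (R : realType) (F : {set index_pair}) :
    {set {set index_pair}} :=
  [set e : {set index_pair} |
     [exists P in F, exists Q in F,
        coassessor R P Q && (e == [set P; Q])]].

(* Mark + for s = false, mark - for s = true. *)
Definition marked (R : realType) (s : bool) (e : {set index_pair}) : bool :=
  [exists P : index_pair, exists Q : index_pair,
     [&& e == [set P; Q], coassessor R P Q &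
         sed_mul (diagonal R P false) (diagonal R Q s) == 0]].

Definition triple_zigzag (R : realType) (F : {set index_pair}) : bool :=
  triangle R F && [forall e in edges R F, marked R true e].

Definition trefoil (R : realType) (F : {set index_pair}) : bool :=
  [&& triangle R F,
      #|[set e in edges R F | marked R false e]| == 2%N
    & #|[set e in edges R F | marked R true e]| == 1%N].

Definition sails (R : realType) (K : {set index_pair}) :
    {set {set index_pair}} :=
  [set F in faces R K | trio R F].

Definition vents (R : realType) (K : {set index_pair}) :
    {set {set index_pair}} :=
  [set F in faces R K | ~~ trio R F].

(* Main.v *)
Require Import Defs.
From mathcomp Require Import all_boot all_order all_algebra reals.

Set Implicit Arguments.
Unset Strict Implicit.
Unset Printing Implicit Defensive.

Import Order.TTheory GRing.Theory Num.Theory.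

(** The product of two diagonals is a sum of four signed basis units, and such
    a sum vanishes exactly when every unit cancels against its opposite, so
    being Co-Assessors is a finite check.  The check shows that the assessors
    are the pairs [kite s x], for seven strut constants [s] and the six vertices
    [x] of an octahedron, with a labelling that makes the seven box-kites look
    the same: [kite s (k, b)] and [kite t (l, c)] are Co-Assessors iff [s = t]
    and [k <> l], the edge between them is marked - iff [b = c], and a face with
    signs [b0, b1, b2] is a sail iff [b0 + b1 + b2] is odd.  Hence a face is a
    triple zigzag if its three signs agree and a trefoil otherwise, and two
    sails with a common edge have the same third sign. *)

(** * Products of diagonals as sums of signed basis units *)

Section SignedBasis.
Local Open Scope ring_scope.

Definition signed_basis (R : realType) (u : bool * nat) : sedenion R :=
  (-1) ^+ u.1 *: basis R u.2.

(* Row [m], column [n] holds the sign of [i_m i_n] for [m, n > 0], with [true]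
   for -; it is computed once because the exhaustive checks read it often. *)
Definition sign_table : seq (seq bool) := Eval vm_compute in
  [seq [seq trip_prod m n == None | n <- iota 0 16] | m <- iota 0 16].

(** Squares need no separate case: [trip_prod m m] is [None], which gives the sign -, and
    [Nat.lxor m m] is 0, so the result encodes -1. *)
Definition unit_mul (m n : nat) : bool * nat :=
  (nth false (nth [::] sign_table m) n, Nat.lxor m n).

Definition flip (s : bool) (u : bool * nat) : bool * nat := (s (+) u.1, u.2).

Definition diagonal_prod (P : nat * nat) (s : bool) (Q : nat * nat) (t : bool) :
    seq (bool * nat) :=
  [:: unit_mul P.1 Q.1; flip t (unit_mul P.1 Q.2);
      flip s (unit_mul P.2 Q.1); flip (s (+) t) (unit_mul P.2 Q.2)].

Definition cancels (l : seq (bool * nat)) : bool :=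
  all (fun u => count_mem u l == count_mem (~~ u.1, u.2) l) l.

Definition annihilates P s Q t : bool := cancels (diagonal_prod P s Q t).

Lemma nth_sign_table (m n : nat) : (m < 16)%N -> (n < 16)%N ->
  nth false (nth [::] sign_table m) n = (trip_prod m n == None).
Proof.
move=> m16 n16; apply/eqP.
have /allP/(_ m) : all (fun i => all (fun j =>
    nth false (nth [::] sign_table i) j == (trip_prod i j == None))
  (iota 0 16)) (iota 0 16) by vm_compute.
by rewrite mem_iota => /(_ m16)/allP/(_ n); rewrite mem_iota; apply.
Qed.

Lemma basis_mul_signed (R : realType) (m n : nat) :
  (0 < m < 16)%N -> (0 < n < 16)%N ->
  basis_mul R m n = signed_basis R (unit_mul m n).
Proof.
move=> hm hn; have /andP[m0 m16] := hm; have /andP[n0 n16] := hn.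
rewrite /signed_basis /= nth_sign_table // /basis_mul (gtn_eqF m0) (gtn_eqF n0).
case: (eqVneq m n) => [<-|mn].
  have /allP/(_ m) : all (fun i => (trip_prod i i == None) &&
      (Nat.lxor i i == 0%N)) (iota 0 16) by vm_compute.
  rewrite mem_iota => /(_ m16)/andP[-> /eqP->].
  by rewrite expr1 scaleN1r.
have /orP[/andP[/eqP-> _]|/andP[/eqP-> /eqP->]] := trip_prod_cover hm hn mn.
  by rewrite expr0 scale1r.
by rewrite expr1 scaleN1r.
Qed.

Lemma signed_basis_flip (R : realType) (s : bool) (u : bool * nat) :
  signed_basis R (flip s u) = (-1) ^+ s *: signed_basis R u.
Proof. by rewrite /signed_basis signr_addb scalerA. Qed.

(** This is bilinearity of the product, in the only shape needed; it is checked on the coefficient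
    of each [basis_mul R m n]. *)
Lemma sed_mul_combination (R : realType) (A B C D : 'I_16) (a b : R) :
  sed_mul (basis R A + a *: basis R B) (basis R C + b *: basis R D) =
  basis_mul R A C + b *: basis_mul R A D + a *: basis_mul R B C
  + (a * b) *: basis_mul R B D.
Proof.
rewrite -!sed_mul_basis /sed_mul !scaler_sumr -!big_split /=.
apply: eq_bigr => m _; rewrite !scaler_sumr -!big_split /=.
apply: eq_bigr => n _; rewrite !mxE !scalerA -!scalerDl; congr (_ *: _).
rewrite mulrDl !mulrDr !addrA -!mulrA; congr (_ + _ + _ + _).
- by rewrite mulrCA.
- by rewrite (mulrCA _ b).
Qed.

Lemma sed_mul_diagonal (R : realType) (P Q : index_pair) (s t : bool) :
  is_pair P -> is_pair Q ->
  sed_mul (diagonal R P s) (diagonal R Q t) =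
  \sum_(u <- diagonal_prod (val P.1, val P.2) s (val Q.1, val Q.2) t)
    signed_basis R u.
Proof.
case: P Q => [A B] [C D] /andP[/= A0 AB] /andP[/= C0 CD].
rewrite sed_mul_combination !basis_mul_signed ?ltn_ord ?andbT //;
  try exact: ltn_trans AB; try exact: ltn_trans CD.
by rewrite !big_cons big_nil !signed_basis_flip signr_addb addr0 !addrA.
Qed.

(** Passing to multiplicities turns a real coordinate into a difference of two natural numbers,
    which can be decided by computation. *)
Lemma signed_basis_sum_coord (R : realType) (l : seq (bool * nat)) (j : 'I_16) :
  (\sum_(u <- l) signed_basis R u) 0 j =
  (count_mem (false, val j) l)%:R - (count_mem (true, val j) l)%:R.
Proof.
elim: l => [|[s n] l IHl]; first by rewrite big_nil mxE subrr.
rewrite big_cons mxE IHl !mxE /= !natrD opprD addrACA; congr (_ + _).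
rewrite !xpair_eqE (eq_sym n); case: s; rewrite /= ?expr1 ?expr0.
  by rewrite mulN1r sub0r.
by rewrite mul1r subr0.
Qed.

(** In characteristic zero a coordinate vanishes iff the two signs of its unit occur equally often.
    The bound on the indices ensures that each unit of [l] is seen by some coordinate. *)
Lemma signed_basis_sum_eq0 (R : realType) (l : seq (bool * nat)) :
  all (fun u => u.2 < 16)%N l ->
  (\sum_(u <- l) signed_basis R u == 0) = cancels l.
Proof.
move=> /allP lt16; apply/eqP/allP => [sum0 [s n] inl /=|can].
  have /= n16 := lt16 _ inl.
  have := signed_basis_sum_coord R l (Ordinal n16).
  rewrite sum0 mxE => /esym/eqP; rewrite subr_eq0 eqr_nat /=.
  by case: s {inl}; rewrite // eq_sym.
apply/rowP => j; rewrite signed_basis_sum_coord mxE; apply/eqP.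
rewrite subr_eq0 eqr_nat; apply/eqP.
(* [cancels] tests only the units occurring in [l]; if neither sign of unit [j] occurs, both counts
   are 0. *)
have [/can/eqP //|f_notin] := boolP ((false, val j) \in l).
have [/can/eqP //|t_notin] := boolP ((true, val j) \in l).
by rewrite !(count_memPn _).
Qed.

Definition nat_pair (P : index_pair) : nat * nat := (val P.1, val P.2).

Lemma lxor_lt16 (m n : nat) : (m < 16)%N -> (n < 16)%N -> (Nat.lxor m n < 16)%N.
Proof.
move=> m16 n16; have /allP/(_ m) : all (fun i =>
  all (fun j => Nat.lxor i j < 16)%N (iota 0 16)) (iota 0 16) by vm_compute.
by rewrite mem_iota => /(_ m16)/allP/(_ n); rewrite mem_iota; apply.
Qed.

Lemma sed_mul_diagonal_eq0 (R : realType) (P Q : index_pair) (s t : bool) :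
  is_pair P -> is_pair Q ->
  (sed_mul (diagonal R P s) (diagonal R Q t) == 0) =
  annihilates (nat_pair P) s (nat_pair Q) t.
Proof.
move=> Ppair Qpair; rewrite sed_mul_diagonal // signed_basis_sum_eq0 //.
by rewrite /= !lxor_lt16 ?ltn_ord.
Qed.

End SignedBasis.

(** * Labelling the assessors by seven octahedra *)

(* Entry [s] lists the low indices of the assessors of the triple zigzag sail
   of the box-kite with strut constant [s + 1]. *)
Definition zigzag_sails : seq (seq nat) :=
  [:: [:: 3; 5; 6]; [:: 1; 6; 7]; [:: 2; 5; 7]; [:: 1; 2; 3];
      [:: 2; 4; 6]; [:: 3; 4; 7]; [:: 1; 4; 5]].

(* Low indices of strut-opposite assessors differ by XOR with the strut
   constant; the two indices of an assessor, by XOR with 8 + strut constant. *)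
Definition kite_nat (v : nat * (nat * bool)) : nat * nat :=
  let: (s, (k, b)) := v in
  let z := nth 0 (nth [::] zigzag_sails s) k in
  let a := if b then z else Nat.lxor z s.+1 in
  (a, Nat.lxor a (8 + s.+1)).

Definition kite (s : 'I_7) (x : octa_vertex) : index_pair :=
  let P := kite_nat (val s, (val x.1, x.2)) in (inord P.1, inord P.2).

Definition signs : seq bool := [:: true; false].

(** The labels are explicit lists over [nat] and [bool], rather than enumerations of finite types,
    so that the exhaustive checks evaluate by [vm_compute]. *)
Definition kite_labels : seq (nat * (nat * bool)) :=
  [seq (s, v) | s <- iota 0 7, v <- [seq (k, b) | k <- iota 0 3, b <- signs]].

Definition nat_pairs : seq (nat * nat) :=
  [seq P <- [seq (a, b) | a <- iota 1 15, b <- iota 1 15] | (P.1 < P.2)].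

Lemma mem_signs (b : bool) : b \in signs.
Proof. by case: b. Qed.

Lemma mem_kite_labels (s : 'I_7) (x : octa_vertex) :
  (val s, (val x.1, x.2)) \in kite_labels.
Proof.
apply: allpairs_f; first by rewrite mem_iota ltn_ord.
by apply: allpairs_f; rewrite ?mem_signs // mem_iota ltn_ord.
Qed.

Lemma kite_labelsP (v : nat * (nat * bool)) :
  v \in kite_labels ->
  exists (s : 'I_7) (x : octa_vertex), v = (val s, (val x.1, x.2)).
Proof.
case/allpairsP => -[s w] [+ /allpairsP[[k b] [+ _ ->]] ->].
rewrite !mem_iota => s7 k3.
by exists (Ordinal s7), (Ordinal k3, b).
Qed.

Lemma mem_nat_pairs (P : index_pair) : is_pair P -> nat_pair P \in nat_pairs.
Proof.
case: P => A B /andP[/= A0 AB]; rewrite mem_filter AB.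
by apply: allpairs_f; rewrite mem_iota ltn_ord andbT // (ltn_trans A0).
Qed.

Lemma nat_pair_inj : injective nat_pair.
Proof. by move=> [A B] [C D] [/val_inj-> /val_inj->]. Qed.

(** Besides ordering the two indices, this ensures that [inord] in [kite] never falls back to its
    default value. *)
Lemma kite_nat_bounds (s : 'I_7) (x : octa_vertex) :
  let P := kite_nat (val s, (val x.1, x.2)) in
  (0 < P.1 < P.2) && (P.2 < 16).
Proof.
have /allP : all (fun v => let P := kite_nat v in
  (0 < P.1 < P.2) && (P.2 < 16)) kite_labels by vm_compute.
by apply; exact: mem_kite_labels.
Qed.

Lemma nat_pair_kite (s : 'I_7) (x : octa_vertex) :
  nat_pair (kite s x) = kite_nat (val s, (val x.1, x.2)).
Proof.
have := kite_nat_bounds s x; rewrite /nat_pair /kite.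
case: kite_nat => a b /= /andP[/andP[_ ab] b16].
by rewrite !inordK // (ltn_trans ab).
Qed.

Lemma kite_is_pair (s : 'I_7) (x : octa_vertex) : is_pair (kite s x).
Proof. by have /andP[] := kite_nat_bounds s x; rewrite -nat_pair_kite. Qed.

Lemma kite_inj (s t : 'I_7) (x y : octa_vertex) :
  kite s x = kite t y -> s = t /\ x = y.
Proof.
move=> /(congr1 nat_pair)/eqP; rewrite !nat_pair_kite.
have /allP/(_ _ (mem_kite_labels s x))/allP/(_ _ (mem_kite_labels t y)) :
  all (fun v => all (fun w => (kite_nat v == kite_nat w) ==> (v == w))
    kite_labels) kite_labels by vm_compute.
move=> /implyP h /h/eqP[/val_inj-> /val_inj eq1 eq2]; split=> //.
by case: x y eq1 eq2 {h} => [? ?] [? ?] /= -> ->.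
Qed.

Lemma eq_kite (s : 'I_7) (x y : octa_vertex) :
  (kite s x == kite s y) = (x == y).
Proof. by apply/eqP/eqP => [/kite_inj[]|->]. Qed.

(** Completeness of the labelling: among all 105 index pairs, with all signs, zero products arise
    only between the 42 labelled ones. *)
Lemma annihilating_pairs_in_kites :
  let K := [seq kite_nat v | v <- kite_labels] in
  all (fun P => all (fun Q => all (fun s => all (fun t =>
    annihilates P s Q t ==> (P \in K) && (Q \in K))
  signs) signs) nat_pairs) nat_pairs.
Proof. by vm_compute. Qed.

(** All box-kites share one multiplication pattern. Only the relative sign [b (+) c] matters, and
    exactly one value of it annihilates along each edge. *)
Lemma annihilates_kite_nat :
  all (fun v => all (fun w => all (fun b => all (fun c =>
    annihilates (kite_nat v) b (kite_nat w) c ==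
    [&& v.1 == w.1, v.2.1 != w.2.1 & b (+) c == (v.2.2 == w.2.2)])
  signs) signs) kite_labels) kite_labels.
Proof. by vm_compute. Qed.

Lemma kite_diagonals_eq0 (R : realType) (s t : 'I_7) (x y : octa_vertex)
    (b c : bool) :
  (sed_mul (diagonal R (kite s x) b) (diagonal R (kite t y) c) == 0%R) =
  [&& s == t, octa_adj x y & b (+) c == (x.2 == y.2)].
Proof.
rewrite sed_mul_diagonal_eq0 ?kite_is_pair // !nat_pair_kite.
have /allP/(_ _ (mem_kite_labels s x))/allP/(_ _ (mem_kite_labels t y)) :=
  annihilates_kite_nat.
by move=> /allP/(_ _ (mem_signs b))/allP/(_ _ (mem_signs c))/eqP.
Qed.

Lemma coassessor_kite (R : realType) (s t : 'I_7) (x y : octa_vertex) :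
  coassessor R (kite s x) (kite t y) = (s == t) && octa_adj x y.
Proof.
rewrite /coassessor !kite_is_pair /=; apply/existsP/andP => [[b /existsP[c]]|].
  by rewrite kite_diagonals_eq0 => /and3P[].
(* Only the sum of the two signs is constrained, so the second one may be taken to be [false]. *)
move=> [st xy]; exists (x.2 == y.2); apply/existsP; exists false.
by rewrite kite_diagonals_eq0 st xy addbF /=.
Qed.

Lemma coassessor_in_kite (R : realType) (P Q : index_pair) :
  coassessor R P Q ->
  exists s x y, [/\ P = kite s x, Q = kite s y & octa_adj x y].
Proof.
move=> coPQ; have /and3P[Ppair Qpair /existsP[b /existsP[c]]] := coPQ.
rewrite sed_mul_diagonal_eq0 // => ann.
have /allP/(_ _ (mem_nat_pairs Ppair))/allP/(_ _ (mem_nat_pairs Qpair)) :=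
  annihilating_pairs_in_kites.
move=> /allP/(_ _ (mem_signs b))/allP/(_ _ (mem_signs c)); rewrite ann implyTb.
case/andP=> /mapP[_ /kite_labelsP[s [x ->]] +] /mapP[_ /kite_labelsP[t [y ->]] +].
rewrite -!nat_pair_kite => /nat_pair_inj eP /nat_pair_inj eQ.
move: coPQ; rewrite eP eQ coassessor_kite => /andP[/eqP<- xy].
by exists s, x, y.
Qed.

(** * Box-kites as connected components *)

Definition kite_set (s : 'I_7) : {set index_pair} :=
  [set kite s x | x : octa_vertex].

Lemma mem_kite_set (s t : 'I_7) (x : octa_vertex) :
  (kite s x \in kite_set t) = (s == t).
Proof.
apply/imsetP/eqP => [[y _ /kite_inj[]] // | <-]; by exists x.
Qed.

(** Two axes never exhaust three. This supplies a neighbour of any vertex and a common neighbour of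
    any two. *)
Lemma next_axis (k l : 'I_3) : exists m : 'I_3, m != k /\ m != l.
Proof.
have /existsP[m] : [exists m : 'I_3, m \notin [set k; l]].
  rewrite -negb_forall; apply/negP => /forallP all_in.
  have : (#|'I_3| <= #|[set k; l]|).
    by apply/subset_leq_card/subsetP => m _; exact: all_in.
  by rewrite card_ord cards2; case: eqVneq.
by rewrite !inE negb_or => /andP[]; exists m.
Qed.

Lemma assessors_kite (R : realType) (P : index_pair) :
  reflect (exists s x, P = kite s x) (P \in assessors R).
Proof.
rewrite inE; apply: (iffP existsP) => [[Q /coassessor_in_kite]|[s [x ->]]].
  by case=> s [x [y [-> _ _]]]; exists s, x.
have [m [mx _]] := next_axis x.1 x.1.
by exists (kite s (m, true)); rewrite coassessor_kite eqxx /octa_adj eq_sym.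
Qed.

Lemma coassessor_sym (R : realType) : symmetric (coassessor R).
Proof.
move=> P Q; apply/idP/idP => /coassessor_in_kite[s [x [y [-> -> xy]]]];
  by rewrite coassessor_kite eqxx /octa_adj eq_sym.
Qed.

Lemma connect_kite (R : realType) (s : 'I_7) (x : octa_vertex) (Q : index_pair) :
  connect (coassessor R) (kite s x) Q = (Q \in kite_set s).
Proof.
apply/connectP/imsetP => [[p + ->]|[y _ ->]].
  (* Every Co-Assessor edge keeps the strut constant, so a path never leaves its octahedron. *)
  elim: p x => [|P p IHp] x /=; first by exists x.
  case/andP=> /coassessor_in_kite[t [u [v [/kite_inj[<- _] -> _]]]].
  exact: IHp.
(* A vertex off the axes of [x] and [y] is adjacent to both; this path of length two also serves
   when [x] and [y] are equal or strut-opposite. *)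
have [m [mx my]] := next_axis x.1 y.1.
exists [:: kite s (m, true); kite s y] => //=.
by rewrite !coassessor_kite eqxx /octa_adj /= my eq_sym mx.
Qed.

Lemma box_kitesE (R : realType) : box_kites R = [set kite_set s | s : 'I_7].
Proof.
have comp s x : [set Q in assessors R | connect (coassessor R) (kite s x) Q]
    = kite_set s.
  apply/setP => Q; rewrite inE connect_kite andb_idl // => /imsetP[y _ ->].
  by apply/assessors_kite; exists s, y.
apply/setP => K; apply/imsetP/imsetP => [[P /assessors_kite[s [x ->]] ->]|].
  by exists s; rewrite ?comp.
case=> s _ ->; exists (kite s (ord0, true)); rewrite ?comp //.
by apply/assessors_kite; exists s, (ord0, true).
Qed.

Lemma partition_box_kites (R : realType) :
  partition (box_kites R) (assessors R).
Proof.
apply: equivalence_partitionP => P Q T _ _ _; split=> [|PQ].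
  exact: connect0.
by apply: same_connect => //; apply/sym_connect_sym/coassessor_sym.
Qed.

Lemma card_box_kites (R : realType) : #|box_kites R| = 7.
Proof.
rewrite box_kitesE card_imset ?card_ord // => s t est; apply/eqP.
by rewrite -(mem_kite_set s t (ord0, true)) -est mem_kite_set.
Qed.

Lemma card_kite_set (s : 'I_7) : #|kite_set s| = 6.
Proof.
rewrite card_imset; last by move=> x y /kite_inj[].
by rewrite card_prod card_ord card_bool.
Qed.

Lemma octa_iso_kite (R : realType) (s : 'I_7) : octa_iso R (kite_set s) (kite s).
Proof.
by split=> // [x y /kite_inj[] //|x y]; rewrite coassessor_kite eqxx.
Qed.

Lemma strut_opposite_unique (R : realType) (s : 'I_7) (P : index_pair) :
  P \in kite_set s ->
  #|[set Q in kite_set s | (Q != P) && ~~ coassessor R P Q]| = 1.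
Proof.
(* The only other vertex on axis [k] has the opposite sign: it is the strut-opposite. *)
case/imsetP=> -[k b] _ ->; rewrite -[RHS](cards1 (kite s (k, ~~ b))).
congr #|pred_of_set _|; apply/setP => Q; rewrite !inE.
apply/andP/eqP => [[/imsetP[[l c] _ ->]]|->].
  rewrite coassessor_kite eqxx eq_kite /octa_adj /= negbK xpair_eqE.
  by case/andP=> + /eqP kl; rewrite kl eqxx; case: b c => -[].
split; first by rewrite mem_kite_set.
by rewrite eq_kite coassessor_kite xpair_eqE /octa_adj /= !eqxx; case: b.
Qed.

(** * Faces of the octahedron *)

(** A face is coded by its signs on the three axes. Unlike a finite function, a triple of booleans
    splits directly into eight concrete cases. *)
Definition face_code : finType := (bool * bool * bool)%type.

Definition code_sign (t : face_code) (k : 'I_3) : bool :=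
  nth false [:: t.1.1; t.1.2; t.2] k.

Definition corner (t : face_code) (k : 'I_3) : octa_vertex := (k, code_sign t k).

Lemma eq_corner (t : face_code) (k l : 'I_3) :
  (corner t k == corner t l) = (k == l).
Proof. by apply/eqP/eqP => [[]|->]. Qed.

Definition octa_face (t : face_code) : {set octa_vertex} :=
  [set corner t k | k : 'I_3].

Definition kite_face (s : 'I_7) (t : face_code) : {set index_pair} :=
  [set kite s x | x in octa_face t].

Lemma code_sign_inj (t u : face_code) : code_sign t =1 code_sign u -> t = u.
Proof.
case: t u => [[a b] c] [[d e] f] eq_tu.
have := (eq_tu (inord 0), eq_tu (inord 1), eq_tu (inord 2)).
by rewrite /code_sign !inordK //= => -[[-> ->] ->].
Qed.

Lemma code_signE (f : 'I_3 -> bool) :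
  exists t : face_code, code_sign t =1 f.
Proof.
exists (f (inord 0), f (inord 1), f (inord 2)) => k.
rewrite /code_sign -[in RHS](inord_val k).
by case: k => -[|[|[|]]].
Qed.

Lemma octa_facesE : octa_faces = [set octa_face t | t in [set: face_code]].
Proof.
apply/setP => F; apply/imsetP/imsetP => [[f _ ->]|[t _ ->]].
  have [t tf] := code_signE f; exists t => //.
  by apply: eq_imset => k; rewrite /corner tf.
exists [ffun k => code_sign t k] => //.
by apply: eq_imset => k; rewrite ffunE.
Qed.

Lemma mem_kite_face (s : 'I_7) (t : face_code) (x : octa_vertex) :
  (kite s x \in kite_face s t) = (x.2 == code_sign t x.1).
Proof.
rewrite mem_imset; last by move=> y z /kite_inj[].
case: x => k b; apply/imsetP/eqP => [[l _ [-> ->]] //|/= ->].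
by exists k.
Qed.

Lemma kite_faceP (s : 'I_7) (t : face_code) (P : index_pair) :
  reflect (exists k, P = kite s (corner t k)) (P \in kite_face s t).
Proof.
apply: (iffP imsetP) => [[_ /imsetP[k _ ->] ->]|[k ->]]; first by exists k.
by exists (corner t k); rewrite ?imset_f.
Qed.

Lemma kite_face_inj (s : 'I_7) : injective (kite_face s).
Proof.
move=> t u etu; apply: code_sign_inj => k; apply/eqP.
by rewrite -(mem_kite_face s u (corner t k)) -etu mem_kite_face.
Qed.

Lemma card_kite_face (s : 'I_7) (t : face_code) : #|kite_face s t| = 3.
Proof.
rewrite card_imset; last by move=> x y /kite_inj[].
by rewrite card_imset ?card_ord // => k l [].
Qed.

Lemma triangle_kite_face (R : realType) (s : 'I_7) (t : face_code) :
  triangle R (kite_face s t).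
Proof.
rewrite /triangle card_kite_face eqxx /=.
apply/forall_inP => _ /kite_faceP[k ->]; apply/forall_inP => _ /kite_faceP[l ->].
apply/implyP; rewrite eq_kite coassessor_kite eqxx /octa_adj /=.
by apply: contra => /eqP->.
Qed.

(** Vertices of a triangle are pairwise adjacent, hence on distinct axes; three of them use each
    axis exactly once. *)
Lemma facesE (R : realType) (s : 'I_7) :
  faces R (kite_set s) = [set kite_face s t | t in [set: face_code]].
Proof.
apply/setP => F; rewrite inE; apply/andP/imsetP => [[subF]|[t _ ->]].
  case/andP=> /eqP F3 /forall_inP adjF.
  (* The sign on axis [k] records whether the positive vertex of that axis lies in [F]. Since both
     sets have three elements, inclusion of [F] in this face suffices. *)
  have [t tE] := code_signE (fun k => kite s (k, true) \in F).
  exists t => //; apply/eqP; rewrite eqEcard F3 card_kite_face andbT.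
  apply/subsetP => P PF; have /imsetP[[k b] _ eP] := subsetP subF _ PF.
  rewrite eP mem_kite_face tE /=; move: PF; rewrite eP; case: b {eP} => PF.
    by rewrite PF.
  (* Otherwise [F] would contain two opposite vertices, which are not Co-Assessors. *)
  rewrite eq_sym eqbF_neg; apply/negP => PF'.
  have /forall_inP/(_ _ PF')/implyP := adjF _ PF.
  rewrite eq_kite coassessor_kite eqxx /octa_adj /= eqxx xpair_eqE andbF.
  by move/(_ isT).
split; last exact: triangle_kite_face.
by apply/subsetP => _ /kite_faceP[k ->]; rewrite mem_kite_set.
Qed.

Lemma faces_octa (R : realType) (s : 'I_7) :
  faces R (kite_set s) =
  [set kite s @: (F : {set octa_vertex}) | F in octa_faces].
Proof. by rewrite facesE octa_facesE -imset_comp. Qed.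

(** * Trios and the parity of a face *)

Definition code_odd (t : face_code) : bool := t.1.1 (+) t.1.2 (+) t.2.

Definition code_const (t : face_code) : bool := (t.1.1 == t.1.2) && (t.1.2 == t.2).

(** All six orders of the axes are checked because [trio] allows any labelling of the three
    assessors. *)
Lemma trio_kite_nat :
  all (fun s => all (fun b => all (fun c => all (fun d =>
    all (fun p : nat * nat * nat =>
      let P := kite_nat (s, (p.1.1, b)) in
      let Q := kite_nat (s, (p.1.2, c)) in
      let T := kite_nat (s, (p.2, d)) in
      perm_eq [:: T.1; T.2] [:: Nat.lxor P.1 Q.1; Nat.lxor P.1 Q.2]
        == b (+) c (+) d)
    [:: (0, 1, 2); (0, 2, 1); (1, 0, 2); (1, 2, 0); (2, 0, 1); (2, 1, 0)])
  signs) signs) signs) (iota 0 7).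
Proof. by vm_compute. Qed.

Lemma trio_condition_kite (s : 'I_7) (t : face_code) (k l m : 'I_3) :
  k != l -> k != m -> l != m ->
  let P := kite s (corner t k) in
  let Q := kite s (corner t l) in
  let T := kite s (corner t m) in
  perm_eq [:: val T.1; val T.2]
    [:: Nat.lxor (val P.1) (val Q.1); Nat.lxor (val P.1) (val Q.2)] = code_odd t.
Proof.
move=> kl km lm P Q T.
change (perm_eq [:: (nat_pair T).1; (nat_pair T).2]
  [:: Nat.lxor (nat_pair P).1 (nat_pair Q).1;
      Nat.lxor (nat_pair P).1 (nat_pair Q).2] = code_odd t).
rewrite !nat_pair_kite.
have /allP/(_ (val s)) := trio_kite_nat; rewrite mem_iota ltn_ord => /(_ isT).
move=> /allP/(_ _ (mem_signs (code_sign t k))).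
move=> /allP/(_ _ (mem_signs (code_sign t l))).
move=> /allP/(_ _ (mem_signs (code_sign t m))).
move=> /allP/(_ (val k, val l, val m)) h.
(* The parity is symmetric in the axes, so it can be read in the order [k], [l], [m]. *)
have -> : code_odd t = code_sign t k (+) code_sign t l (+) code_sign t m.
  rewrite /code_odd /code_sign; case: t {P Q T h} => [[a b] c] /=.
  move: k l m kl km lm.
  move=> -[[|[|[|//]]] ?] -[[|[|[|//]]] ?] -[[|[|[|//]]] ?] //= _ _ _;
    by case: a; case: b; case: c.
(* It remains to see that three distinct axes form one of the six listed orders. *)
apply/eqP/h; move: k l m kl km lm {P Q T h}.
by move=> -[[|[|[|//]]] ?] -[[|[|[|//]]] ?] -[[|[|[|//]]] ?].
Qed.

Definition axis0 : 'I_3 := inord 0.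
Definition axis1 : 'I_3 := inord 1.
Definition axis2 : 'I_3 := inord 2.

Lemma axes_distinct : [/\ axis0 != axis1, axis0 != axis2 & axis1 != axis2].
Proof. by split; rewrite -val_eqE /= !inordK. Qed.

Lemma axesE (k : 'I_3) : [\/ k = axis0, k = axis1 | k = axis2].
Proof.
case: k => -[|[|[|]]] // ?; [constructor 1|constructor 2|constructor 3];
  by apply: val_inj; rewrite /= inordK.
Qed.

Lemma kite_face3 (s : 'I_7) (t : face_code) :
  kite_face s t =
  [set kite s (corner t axis0); kite s (corner t axis1); kite s (corner t axis2)].
Proof.
apply/setP => P; rewrite !inE; apply/kite_faceP/idP => [[k ->]|].
  by case: (axesE k) => ->; rewrite eqxx ?orbT.
by case/orP=> [/orP[]|] /eqP->; eexists.
Qed.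

Lemma trio_kite_face (R : realType) (s : 'I_7) (t : face_code) :
  trio R (kite_face s t) = code_odd t.
Proof.
rewrite /trio triangle_kite_face /=; apply/existsP/idP.
  case=> P /existsP[Q /existsP[T /andP[/eqP eF]]].
  have inF X : X \in [set P; Q; T] -> exists k, X = kite s (corner t k).
    by rewrite -eF => /kite_faceP.
  have [k eP] : exists k, P = kite s (corner t k) by apply: inF; rewrite !inE eqxx.
  have [l eQ] : exists k, Q = kite s (corner t k).
    by apply: inF; rewrite !inE eqxx orbT.
  have [m eT] : exists k, T = kite s (corner t k).
    by apply: inF; rewrite !inE eqxx orbT.
  (* A face has three elements, so [P], [Q], [T] are distinct and so are their axes. *)
  have card3 := card_kite_face s t; rewrite eF {eF inF} in card3.
  rewrite eP eQ eT in card3 *; rewrite trio_condition_kite //;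
    apply: contra_eq_neq card3 => ->.
  - by rewrite setUid cards2; case: (kite _ _ != _).
  - by rewrite setUAC setUid cards2; case: (kite _ _ != _).
  - by rewrite -setUA setUid cards2; case: (kite _ _ != _).
move=> todd; have [n01 n02 n12] := axes_distinct.
exists (kite s (corner t axis0)); apply/existsP; exists (kite s (corner t axis1)).
apply/existsP; exists (kite s (corner t axis2)).
by rewrite kite_face3 eqxx trio_condition_kite.
Qed.

(** * Edges of a face and their marks *)

Definition kite_edge (s : 'I_7) (t : face_code) (k l : 'I_3) : {set index_pair} :=
  [set kite s (corner t k); kite s (corner t l)].

Lemma kite_edgeC (s : 'I_7) (t : face_code) (k l : 'I_3) :
  kite_edge s t k l = kite_edge s t l k.
Proof. exact: setUC. Qed.

Lemma edges_kite_face (R : realType) (s : 'I_7) (t : face_code) :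
  edges R (kite_face s t) =
  [set kite_edge s t axis0 axis1; kite_edge s t axis0 axis2; kite_edge s t axis1 axis2].
Proof.
have [n01 n02 n12] := axes_distinct.
apply/setP => e; rewrite inE; apply/exists_inP/idP.
  case=> _ /kite_faceP[k ->] /exists_inP[_ /kite_faceP[l ->]].
  rewrite coassessor_kite eqxx /octa_adj => /andP[/= kl /eqP ->].
  rewrite -/(kite_edge s t k l) !inE.
  case: (axesE k) (axesE l) kl => -> [] ->; rewrite ?eqxx ?orbT // => _;
    by rewrite kite_edgeC eqxx ?orbT.
have edge k l : k != l -> exists2 P, P \in kite_face s t &
    [exists Q in kite_face s t, coassessor R P Q && (kite_edge s t k l == [set P; Q])].
  move=> kl; exists (kite s (corner t k)); first by apply/kite_faceP; exists k.
  apply/exists_inP; exists (kite s (corner t l)).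
    by apply/kite_faceP; exists l.
  by rewrite coassessor_kite eqxx /octa_adj kl /=.
by rewrite !inE => /orP[/orP[]|] /eqP->; exact: edge.
Qed.

Lemma marked_kite_edge (R : realType) (s : 'I_7) (t : face_code) (b : bool)
    (k l : 'I_3) : k != l ->
  marked R b (kite_edge s t k l) = (b == (code_sign t k == code_sign t l)).
Proof.
move=> kl; apply/existsP/eqP => [[P /existsP[Q /and3P[/eqP eE coPQ prod0]]]|bE].
  have : P \in kite_edge s t k l by rewrite eE !inE eqxx.
  have : Q \in kite_edge s t k l by rewrite eE !inE eqxx orbT.
  (* [P] and [Q] are the two ends in either order: the case [P = Q] contradicts adjacency, and the
     criterion for the mark is symmetric. *)
  rewrite !inE => /orP[]/eqP eQ /orP[]/eqP eP; move: prod0 coPQ;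
    rewrite eP eQ kite_diagonals_eq0 coassessor_kite eqxx /octa_adj ?eqxx //=.
    by case/andP=> _ /eqP; rewrite eq_sym.
  by case/andP=> _ /eqP.
exists (kite s (corner t k)); apply/existsP; exists (kite s (corner t l)).
by rewrite eqxx coassessor_kite kite_diagonals_eq0 !eqxx /octa_adj kl /= bE.
Qed.

Lemma kite_edges_distinct (s : 'I_7) (t : face_code) :
  [/\ kite_edge s t axis0 axis1 != kite_edge s t axis0 axis2,
      kite_edge s t axis0 axis1 != kite_edge s t axis1 axis2
    & kite_edge s t axis0 axis2 != kite_edge s t axis1 axis2].
Proof.
have [n01 n02 n12] := axes_distinct.
split; apply/eqP => /setP eE.
- have := eE (kite s (corner t axis1)).
  by rewrite !inE !eq_kite !eq_corner eqxx eq_sym (negPf n01) (negPf n12).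
- have := eE (kite s (corner t axis0)).
  by rewrite !inE !eq_kite !eq_corner eqxx (negPf n01) (negPf n02).
- have := eE (kite s (corner t axis0)).
  by rewrite !inE !eq_kite !eq_corner eqxx (negPf n01) (negPf n02).
Qed.

Lemma card_set3_filter (T : finType) (a b c : T) (p : pred T) :
  a != b -> a != c -> b != c ->
  #|[set x in [set a; b; c] | p x]| = (p a + p b + p c).
Proof.
move=> ab ac bc; rewrite -sum1dep_card big_mkcondr /= -setUA.
rewrite big_setU1 ?inE ?negb_or ?ab //= big_setU1 ?inE //= big_set1 addnA.
by case: (p a); case: (p b); case: (p c).
Qed.

Lemma card_marked_edges (R : realType) (s : 'I_7) (t : face_code) (b : bool) :
  #|[set e in edges R (kite_face s t) | marked R b e]| =
  ((b == (t.1.1 == t.1.2)) + (b == (t.1.1 == t.2)) + (b == (t.1.2 == t.2))).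
Proof.
have [n01 n02 n12] := axes_distinct; have [e1 e2 e3] := kite_edges_distinct s t.
rewrite edges_kite_face card_set3_filter // !marked_kite_edge //.
by rewrite /code_sign !inordK.
Qed.

(** Three signs that are not all equal contain exactly one equal pair, hence one edge marked - and
    two marked +; three equal signs give no edge marked +. *)
Lemma trefoil_kite_face (R : realType) (s : 'I_7) (t : face_code) :
  trefoil R (kite_face s t) = ~~ code_const t.
Proof.
rewrite /trefoil triangle_kite_face !card_marked_edges /code_const.
by case: t => [[[] []] []].
Qed.

Lemma triple_zigzag_kite_face (R : realType) (s : 'I_7) (t : face_code) :
  triple_zigzag R (kite_face s t) = code_const t.
Proof.
have [n01 n02 n12] := axes_distinct.
have all3 : [forall e in edges R (kite_face s t), marked R true e] =
  [&& marked R true (kite_edge s t axis0 axis1), marked R true (kite_edge s t axis0 axis2)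
    & marked R true (kite_edge s t axis1 axis2)].
  rewrite edges_kite_face; apply/forall_inP/and3P => [all_e|[m1 m2 m3] e].
    by split; apply: all_e; rewrite !inE eqxx ?orbT.
  by rewrite !inE => /orP[/orP[]|] /eqP->.
rewrite /triple_zigzag triangle_kite_face all3 !marked_kite_edge //.
rewrite /code_sign !inordK //= /code_const.
by case: t {all3} => [[[] []] []].
Qed.

Lemma kite_edge_disjoint (R : realType) (s : 'I_7) (t u : face_code) :
  code_odd t = code_odd u -> t != u ->
  edges R (kite_face s t) :&: edges R (kite_face s u) = set0.
Proof.
move=> odd_tu; apply: contra_neq_eq => /set0Pn[e /setIP[]].
rewrite inE => /exists_inP[_ /kite_faceP[k ->]].
case/exists_inP=> _ /kite_faceP[l ->].
rewrite coassessor_kite eqxx /octa_adj => /andP[/= kl /eqP ->].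
rewrite inE => /exists_inP[P Pu /exists_inP[Q Qu /andP[_ /eqP eE]]].
have sub X : X \in [set P; Q] -> X \in kite_face s u.
  by rewrite !inE => /orP[]/eqP->.
have : kite s (corner t k) \in kite_face s u by apply: sub; rewrite -eE !inE eqxx.
have : kite s (corner t l) \in kite_face s u.
  by apply: sub; rewrite -eE !inE eqxx orbT.
(* The two codes agree on the distinct axes [k] and [l], and equal parity forces agreement on the
   third. *)
rewrite !mem_kite_face /code_sign /=; move: kl odd_tu {eE Pu Qu sub}.
case: t u => [[a b] c] [[d e'] f].
by move: k l => -[[|[|[|//]]] ?] -[[|[|[|//]]] ?] //= _;
  case: a; case: b; case: c; case: d; case: e'; case: f.
Qed.

(** * Counting sails and vents through face codes *)

Lemma filter_imset (aT rT : finType) (f : aT -> rT) (A : {set aT})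
    (q : pred rT) :
  [set y in f @: A | q y] = f @: [set x in A | q (f x)].
Proof.
apply/setP => y; rewrite inE; apply/andP/imsetP => [[/imsetP[x xA ->] qx]|].
  by exists x; rewrite // inE xA.
by case=> x; rewrite inE => /andP[xA qx] ->; rewrite imset_f.
Qed.

Lemma sailsE (R : realType) (s : 'I_7) :
  sails R (kite_set s) = kite_face s @: [set t | code_odd t].
Proof.
rewrite /sails facesE filter_imset; congr (_ @: pred_of_set _).
by apply/setP => t; rewrite !inE trio_kite_face.
Qed.

Lemma ventsE (R : realType) (s : 'I_7) :
  vents R (kite_set s) = kite_face s @: [set t | ~~ code_odd t].
Proof.
rewrite /vents facesE filter_imset; congr (_ @: pred_of_set _).
by apply/setP => t; rewrite !inE trio_kite_face.
Qed.

(** With the eight codes written out, each count for a concrete predicate is settled by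
    evaluation. *)
Lemma card_face_codes (p : pred face_code) :
  #|[set t | p t]| =
  (p (true, true, true) + p (true, true, false)
   + (p (true, false, true) + p (true, false, false))
   + (p (false, true, true) + p (false, true, false)
      + (p (false, false, true) + p (false, false, false)))).
Proof.
rewrite cardsE -sum1_card big_mkcond /=.
transitivity (\sum_a \sum_b \sum_c p (a, b, c) : nat).
  by rewrite !pair_bigA /=; apply: eq_bigr => -[[a b] c] _; rewrite unfold_in;
    case: (p _).
by rewrite !big_bool.
Qed.

Lemma card_kite_faces (s : 'I_7) (A : {set face_code}) :
  #|kite_face s @: A| = #|A|.
Proof. exact/card_imset/kite_face_inj. Qed.

Lemma card_faces_kite (R : realType) (s : 'I_7) : #|faces R (kite_set s)| = 8.
Proof. by rewrite facesE card_kite_faces cardsT !card_prod card_bool. Qed.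

Lemma sails_edge_disjoint (R : realType) (s : 'I_7) (F G : {set index_pair}) :
  F \in sails R (kite_set s) -> G \in sails R (kite_set s) -> F != G ->
  edges R F :&: edges R G = set0.
Proof.
rewrite !sailsE => /imsetP[t + ->] /imsetP[u + ->]; rewrite !inE => todd uodd.
by rewrite (inj_eq (@kite_face_inj s)); apply: kite_edge_disjoint; rewrite todd.
Qed.

Lemma trefoils_kite (R : realType) (s : 'I_7) (p : pred face_code) :
  #|[set F in kite_face s @: [set t | p t] | trefoil R F]| =
  #|[set t | p t && ~~ code_const t]|.
Proof.
rewrite filter_imset card_kite_faces; congr #|pred_of_set _|.
by apply/setP => t; rewrite !inE trefoil_kite_face.
Qed.

Lemma triple_zigzags_kite (R : realType) (s : 'I_7) (p : pred face_code) :
  #|[set F in kite_face s @: [set t | p t] | triple_zigzag R F]| =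
  #|[set t | p t && code_const t]|.
Proof.
rewrite filter_imset card_kite_faces; congr #|pred_of_set _|.
by apply/setP => t; rewrite !inE triple_zigzag_kite_face.
Qed.

Theorem mainTheorem3 (R : realType) :
  [/\ partition (box_kites R) (assessors R),
      #|box_kites R| = 7
    & forall K : {set index_pair}, K \in box_kites R ->
      [/\ #|K| = 6,
          (exists2 f : octa_vertex -> index_pair, octa_iso R K f
             & faces R K = [set f @: (F : {set octa_vertex}) | F in octa_faces])
          /\ (forall P : index_pair, P \in K ->
                #|[set Q in K | (Q != P) && ~~ coassessor R P Q]| = 1),
          #|faces R K| = 8,
          [/\ #|sails R K| = 4,
              forall F G : {set index_pair},
                F \in sails R K -> G \in sails R K -> F != G ->
                edges R F :&: edges R G = set0,
              #|[set F in sails R K | trefoil R F]| = 3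
            & #|[set F in sails R K | triple_zigzag R F]| = 1]
        & [/\ #|vents R K| = 4,
              #|[set F in vents R K | trefoil R F]| = 3
            & #|[set F in vents R K | triple_zigzag R F]| = 1]]].
Proof.
split; [exact: partition_box_kites | exact: card_box_kites |].
move=> K; rewrite box_kitesE => /imsetP[s _ ->]; split.
- exact: card_kite_set.
- split; last by move=> P; exact: strut_opposite_unique.
  by exists (kite s); [exact: octa_iso_kite | exact: faces_octa].
- exact: card_faces_kite.
- split; last 2 first.
  (* Of the four odd codes only [(true, true, true)] is constant. *)
  + by rewrite sailsE trefoils_kite card_face_codes.
  + by rewrite sailsE triple_zigzags_kite card_face_codes.
  + by rewrite sailsE card_kite_faces card_face_codes.
  exact: sails_edge_disjoint.
(* Of the four even codes only [(false, false, false)] is constant. *)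
- by rewrite ventsE trefoils_kite triple_zigzags_kite card_kite_faces
    !card_face_codes.
Qed.
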